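(* Let $f(x)=x^3+a_2x^2+a_1x+a_0\in\mathbb{Z}[x]$ be an irreducible polynomial with three real roots $\vartheta=\vartheta^{(1)},\vartheta^{(2)},\vartheta^{(3)}$, let $L=\mathbb{Q}(\vartheta)$, let $d>0$ be a square-free integer, $M=\mathbb{Q}(i\sqrt d)$, and set $\omega=i\sqrt d$ if $-d\equiv 2,3 \pmod 4$ and $\omega=\frac{1+i\sqrt d}{2}$ if $-d\equiv 1\pmod 4$. Let $\mathcal{O}$ be the order of $K=\mathbb{Q}(\vartheta,i\sqrt d)$ with $\mathbb{Z}$-basis $(1,\vartheta,\vartheta^2,\omega,\omega\vartheta,\omega\vartheta^2)$. Suppose that $$\alpha=x_0+x_1\vartheta+x_2\vartheta^2+y_0\omega+y_1\omega\vartheta+y_2\omega\vartheta^2\in\mathcal{O}\qquad (x_j,y_j\in\mathbb{Z})$$ generates a power integral basis in $\mathcal{O}$. Then, with the polynomial $F$ defined in the context, $$F(x_1,x_2,y_0,y_1,y_2)=\pm1\quad\text{and}\quad N_{L/\mathbb{Q}}(y_0+y_1\vartheta+y_2\vartheta^2)=\pm1 .$$ Further, if $-d\equiv 2,3\pmod 4$, then $$|N_{L/\mathbb{Q}}(x_1-(a_2+\vartheta)x_2)|\le 1\quad\text{and}\quad |N_{L/\mathbb{Q}}(y_1-(a_2+\vartheta)y_2)|\le\frac{1}{(\sqrt d)^3};$$ and if $-d\equiv 1\pmod 4$, then $$|N_{L/\mathbb{Q}}((2x_1+y_1)-(a_2+\vartheta)(2x_2+y_2))|\le 8\quad\text{and}\quad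 |N_{L/\mathbb{Q}}(y_1-(a_2+\vartheta)y_2)|\le\frac{8}{(\sqrt d)^3}.$$
   Context: $N_{L/\mathbb{Q}}$ denotes the field norm. An element $\alpha\in\mathcal{O}$ generates a power integral basis in $\mathcal{O}$ if $\mathcal{O}=\mathbb{Z}[\alpha]$, i.e. $(1,\alpha,\ldots,\alpha^5)$ is a $\mathbb{Z}$-basis of $\mathcal{O}$; equivalently, its index $I(\alpha)=\sqrt{|D(\alpha)/D_{\mathcal{O}}|}$ equals $1$, where $D(\alpha)$ is the discriminant of $\alpha$ and $D_{\mathcal{O}}$ is the discriminant of $\mathcal{O}$. Let $\omega'$ be the conjugate of $\omega$ over $\mathbb{Q}$ (its complex conjugate). For $j=1,2,3$ put $$\alpha^{(1,j)}=x_0+x_1\vartheta^{(j)}+x_2(\vartheta^{(j)})^2+y_0\omega+y_1\omega\vartheta^{(j)}+y_2\omega(\vartheta^{(j)})^2,$$ $$\alpha^{(2,j)}=x_0+x_1\vartheta^{(j)}+x_2(\vartheta^{(j)})^2+y_0\omega'+y_1\omega'\vartheta^{(j)}+y_2\omega'(\vartheta^{(j)})^2 .$$ Keeping the coefficients $x_j,y_j$ as variables, define $$F(x_1,x_2,y_0,y_1,y_2)=(\alpha^{(1,1)}-\alpha^{(2,2)})(\alpha^{(1,1)}-\alpha^{(2,3)})(\alpha^{(1,2)}-\alpha^{(2,1)})(\alpha^{(1,2)}-\alpha^{(2,3)})(\alpha^{(1,3)}-\alpha^{(2,1)})(\alpha^{(1,3)}-\alpha^{(2,2)}),$$ which is a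 polynomial with coefficients in $\mathbb{Z}$ (it does not depend on $x_0$). *)

(* Defs.v *)
From HB Require Import structures.
From mathcomp Require Import all_boot all_order all_algebra all_field.

Set Implicit Arguments.
Unset Strict Implicit.
Unset Printing Implicit Defensive.

Import Order.TTheory GRing.Theory Num.Theory.

Local Open Scope ring_scope.

Definition monic_cubic (a0 a1 a2 : int) : {poly int} :=
  'X^3 + a2%:P * 'X^2 + a1%:P * 'X + a0%:P.

Definition squarefree (n : nat) : Prop :=
  forall p : nat, prime p -> ~~ (p ^ 2 %| n)%N.

(* omega as a function of s = i * sqrt d; for a square-free d the second
   branch is the case -d = 2, 3 mod 4. *)
Definition omega (R : fieldType) (d : nat) (s : R) : R :=
  if (- d%:Z == 1 %[mod 4])%Z then (1 + s) / 2 else s.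

Definition elt (R : comNzRingType) (t w : R) (x0 x1 x2 y0 y1 y2 : int) : R :=
  x0%:~R + x1%:~R * t + x2%:~R * t ^+ 2
  + y0%:~R * w + y1%:~R * (w * t) + y2%:~R * (w * t ^+ 2).

Definition order_O (K : fieldType) (t w : K) : K -> Prop :=
  inIntSpan [tuple 1; t; t ^+ 2; w; w * t; w * t ^+ 2].

(* O = Z[a] *)
Definition generates_power_integral_basis
    (K : fieldType) (O : K -> Prop) (a : K) : Prop :=
  forall z : K, O z <-> exists p : {poly int}, z = (map_poly intr p).[a].

(* The norm N_{E/k} of an element z of the intermediate field E of K/k: the
   determinant of multiplication by z on the k-vector space E (the value is
   meaningless for z outside E). *)
Definition field_norm (k : fieldType) (K : fieldExtType k) (E : {vspace K})
    (z : K) : k :=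
  \det (\matrix_(i < \dim E, j < \dim E)
          coord (vbasis E) j ((vbasis E)`_i * z)).

(* The ordered pairs j <> k run over the six factors
   alpha^(1,j) - alpha^(2,k); x0 cancels in each of them, so it is set to 0. *)
Definition formF (th : 'I_3 -> algC) (w w' : algC)
    (x1 x2 y0 y1 y2 : int) : algC :=
  \prod_(j < 3) \prod_(k < 3 | k != j)
    (elt (th j) w 0 x1 x2 y0 y1 y2 - elt (th k) w' 0 x1 x2 y0 y1 y2).

Lemma formF_x0 th w w' x0 x1 x2 y0 y1 y2 :
  formF th w w' x1 x2 y0 y1 y2 =
  \prod_(j < 3) \prod_(k < 3 | k != j)
    (elt (th j) w x0 x1 x2 y0 y1 y2 - elt (th k) w' x0 x1 x2 y0 y1 y2).
Proof.
have eltE (R : comNzRingType) (t u : R) :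
  elt t u x0 x1 x2 y0 y1 y2 = x0%:~R + elt t u 0 x1 x2 y0 y1 y2.
  by rewrite /elt add0r !addrA.
apply: eq_bigr => j _; apply: eq_bigr => k _.
by rewrite [in RHS]eltE [X in _ = _ - X]eltE [X in _ = X - _]addrC addrKA.
Qed.

(* Main.v *)
Require Import Defs.
From HB Require Import structures.
From mathcomp Require Import all_boot all_order all_algebra all_field.
From mathcomp Require Import ring.

Import Order.TTheory GRing.Theory Num.Theory.

Local Open Scope ring_scope.

(** Let [w'] be the conjugate of [w = iota omega].  The six embeddings of [K]
    into the complex numbers send [theta] to one of its conjugates and
    [omega] to [w] or [w'].  Applied to a Z-basis of the order they give a
    6 x 6 matrix [B]; applied to the powers of [alpha] they give a Vandermonde
    matrix.  When [alpha] generates a power integral basis, the two bases of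
    the order differ by an integer matrix of determinant +-1, so the Vandermonde
    determinant is [+- \det B] ([power_basis_det]).

    Both determinants factor.  The order is a tensor product of [Z[theta]] and
    [Z[omega]], hence [\det B = (w' - w)^3 D^2], with [D] the Vandermonde
    determinant of the conjugates of [theta].  The differences of conjugates
    of [alpha] split into four groups ([det_conjugate_powers]): those sharing
    [omega |-> w] give [D] times the product of three numbers [gamma_l], those
    sharing [omega |-> w'] give [D] times the product of the [gamma_l'], those
    over the same conjugate of [theta] give [(w' - w)^3 N] with [N] the norm of
    [y0 + y1 theta + y2 theta^2], and the rest is the form [F].  Here
      [gamma_l = X_l + w Y_l],  [X_l = x1 - (a2 + theta_l) x2],
      [Y_l = y1 - (a2 + theta_l) y2],
    because the two other roots add up to [- (a2 + theta_l)].  Cancelling,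
      [N * G * F = +-1]  with  [G = \prod_l gamma_l gamma_l'].

    All three factors are algebraic integers, while [N] and [G] are norms from
    [Q(theta)] and so rational; a rational algebraic integer that is a unit is
    [+-1] ([Crat_Aint_unit]).  Thus [N = +-1], [G = 1] since [G >= 0], and then
    [F = +-1].  Finally [w = (t + c S) / 2] with [S = i sqrt d] and
    [(t, c) = (0, 2)] or [(1, 1)], so that
      [4 gamma_l gamma_l' = (2 X_l + t Y_l)^2 + d c^2 Y_l^2].
    Both squares are nonnegative and the product of these sums over [l] is 64,
    which bounds the product of each kind of square ([norm_prod_le]) and gives
    the inequalities. *)

(** * Embeddings of K into the complex numbers *)

(** The first isomorphism theorem for a surjection [g] onto a field; it
    serves to define an embedding of a field through a presentation of it. *)
Lemma rmorphism_factor (R : nzRingType) (K L : fieldType)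
    (g : {rmorphism R -> K}) (h : {rmorphism R -> L}) :
    (forall z, exists r, g r = z) -> (forall r, g r = 0 -> h r = 0) ->
  exists sg : {rmorphism K -> L}, forall r, sg (g r) = h r.
Proof.
move=> gS ker.
have gS' z : exists r, g r == z by have [r <-] := gS z; exists r.
pose sec z := xchoose (gS' z).
have secK z : g (sec z) = z := eqP (xchooseP (gS' z)).
have hE r r' : g r = g r' -> h r = h r'.
  move=> grr'; apply/eqP; rewrite -subr_eq0 -rmorphB ker //.
  by rewrite rmorphB grr' subrr.
pose f z := h (sec z).
have fB : GRing.zmod_morphism f.
  by move=> x y; rewrite /f -rmorphB; apply: hE; rewrite rmorphB !secK.
have fM : GRing.monoid_morphism f.
  split=> [|x y].
    by rewrite /f -(rmorph1 h); apply: hE; rewrite rmorph1 secK.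
  by rewrite /f -rmorphM; apply: hE; rewrite rmorphM !secK.
pose fA := GRing.isZmodMorphism.Build K L f fB.
pose fR := GRing.isMonoidMorphism.Build K L f fM.
pose sg : {rmorphism K -> L} := HB.pack f fA fR.
by exists sg => r; apply: hE; rewrite secK.
Qed.

Lemma irreducible_root_dvd (k L : fieldType) (phi : {rmorphism k -> L})
    (f p : {poly k}) (x : L) :
    irreducible_poly f -> root (map_poly phi f) x -> root (map_poly phi p) x ->
  f %| p.
Proof.
move=> f_irr fx px; have : root (map_poly phi (gcdp f p)) x.
  by rewrite gcdp_map root_gcd fx.
have [/eqP/size_poly1P[c c0 ->] | g1 _] := eqVneq (size (gcdp f p)) 1.
  by rewrite map_polyC /root hornerC fmorph_eq0 (negPf c0).
have /andP[_ fg] := apply_irredp f_irr g1 (dvdp_gcdl f p).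
exact: dvdp_trans fg (dvdp_gcdr f p).
Qed.

(** Evaluation of bivariate polynomials: the inner variable goes to [x], the
    outer one to [y]. *)
Definition eval2 (k L : fieldType) (phi : {rmorphism k -> L}) (x y : L)
    : {rmorphism {poly {poly k}} -> L} :=
  horner_morph (f := horner_morph (f := phi) (u := x) (fun=> mulrC _ _))
               (u := y) (fun=> mulrC _ _).

Arguments eval2 {k L} phi x y.

Lemma eval2C (k L : fieldType) (phi : {rmorphism k -> L}) (x y : L)
  (q : {poly k}) : eval2 phi x y q%:P = (map_poly phi q).[x].
Proof. exact: horner_morphC. Qed.

Lemma eval2X (k L : fieldType) (phi : {rmorphism k -> L}) (x y : L) :
  eval2 phi x y 'X = y.
Proof. exact: horner_morphX. Qed.

Lemma eval2_lin (k L : fieldType) (phi : {rmorphism k -> L}) (x y : L)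
    (T : {poly {poly k}}) : (size T <= 2)%N ->
  eval2 phi x y T = (map_poly phi T`_0).[x] + (map_poly phi T`_1).[x] * y.
Proof.
move=> sT; pose phi2 : {rmorphism {poly k} -> L} :=
  horner_morph (f := phi) (u := x) (fun=> mulrC _ _).
rewrite -[LHS]/((map_poly phi2 T).[y]) (@horner_coef_wide _ 2); last first.
  exact: leq_trans (size_poly _ _) sT.
by rewrite big_ord_recl big_ord1 !coef_map expr0 expr1 mulr1.
Qed.

(** An embedding of [K = Q(theta, s)] that moves [theta] to a conjugate and
    keeps [s] exists because [s] is independent of the real field [Q(theta)]:
    a relation [A(theta) + B(theta) s = 0] forces [A(theta) = B(theta) = 0]
    when [theta] is real and [s] is not, and vanishing at [theta] is passed to
    [t] by irreducibility of [f].  Any polynomial relation between [theta]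
    and [s] has this shape after division by [Y^2 - e]. *)
Lemma conjugate_embedding (f : {poly rat}) (K : fieldExtType rat)
    (iota : {rmorphism K -> algC}) (theta s : K) (e : rat) (t : algC) :
    irreducible_poly f -> root (map_poly ratr f) (iota theta) ->
    root (map_poly ratr f) t -> iota theta \is Num.real ->
    s ^+ 2 = e%:A -> iota s \isn't Num.real ->
    <<1 & [:: theta; s]>>%VS = {:K}%VS ->
  exists sg : {rmorphism K -> algC}, sg theta = t /\ sg s = iota s.
Proof.
move=> f_irr ftheta ft thetaR s2 sR gen.
have ratE : iota \o in_alg K =1 ratr by exact: fmorph_eq_rat.
pose g := eval2 (in_alg K) theta s.
pose h := eval2 (ratr : {rmorphism rat -> algC}) t (iota s).
have gS z : exists T, g T = z.
  have : z \in <<1 & [:: theta; s]>>%VS by rewrite gen memvf.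
  rewrite adjoin_cons adjoin_seq1 => /Fadjoin_polyP[p pE ->].
  have qP (i : 'I_(size p)) : exists q, p`_i = (map_poly (in_alg K) q).[theta].
    exact/Fadjoin1_polyP/(polyOverP pE).
  have [q qE] := fin_all_exists qP.
  exists (\sum_i (q i)%:P * 'X^i); rewrite horner_coef rmorph_sum.
  apply: eq_bigr => i _; rewrite rmorphM rmorphXn qE.
  by rewrite [g _]eval2C [g 'X]eval2X.
(* It remains to show that relations between theta and s also hold between
   t and s. *)
have [] := @rmorphism_factor _ K algC g h gS; last first.
  move=> sg sgE; exists sg; have := (sgE 'X%:P, sgE 'X).
  by rewrite /g /h !eval2C !eval2X !map_polyX !hornerX => -[].
move=> T; pose D : {poly {poly rat}} := 'X^2 - e%:P%:P.
have D_monic : D \is monic by rewrite monicXnsubC.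
rewrite [T](Pdiv.RingMonic.rdivp_eq D_monic).
set r := Pdiv.CommonRing.rmodp _ _.
have sr : (size r <= 2)%N.
  rewrite -ltnS -(@size_XnsubC _ 2 e%:P) //.
  by rewrite Pdiv.Ring.ltn_rmodpN0 ?monic_neq0.
have gD : g D = 0.
  by rewrite rmorphB rmorphXn /g eval2X eval2C map_polyC hornerC s2 subrr.
have S2 : iota s ^+ 2 = ratr e by rewrite -rmorphXn s2 -ratE.
have hD : h D = 0.
  by rewrite rmorphB rmorphXn /h eval2X eval2C map_polyC hornerC S2 subrr.
set q := Pdiv.CommonRing.rdivp _ _.
have -> : g (q * D + r) = g r by rewrite rmorphD rmorphM gD mulr0 add0r.
have -> : h (q * D + r) = h r by rewrite rmorphD rmorphM hD mulr0 add0r.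
rewrite /g /h !eval2_lin //.
have iotaE (A : {poly rat}) :
    iota (map_poly (in_alg K) A).[theta] = (map_poly ratr A).[iota theta].
  by rewrite -horner_map -map_poly_comp (eq_map_poly ratE).
have realE (A : {poly rat}) : (map_poly ratr A).[iota theta] \is Num.real.
  apply: rpred_horner => //; apply/polyOverP => i; rewrite coef_map /=.
  by rewrite Creal_Crat ?Crat_rat.
move/(congr1 iota); rewrite rmorph0 rmorphD rmorphM /= !iotaE => AB0.
have B0 : (map_poly ratr r`_1).[iota theta] = 0.
  apply: contraNeq sR => nzB.
  have -> : iota s = - (map_poly ratr r`_0).[iota theta] /
      (map_poly ratr r`_1).[iota theta].
    apply: (mulIf nzB); rewrite divfK // mulrC; apply/eqP.
    by rewrite -addr_eq0 addrC AB0.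
  by rewrite rpred_div ?rpredN.
have A0 : (map_poly ratr r`_0).[iota theta] = 0.
  by rewrite B0 mul0r addr0 in AB0.
have conj0 (A : {poly rat}) :
    (map_poly ratr A).[iota theta] = 0 -> (map_poly ratr A).[t] = 0.
  move/eqP => At; apply/rootP.
  have : f %| A by apply: (@irreducible_root_dvd _ algC ratr _ _ (iota theta)).
  rewrite -(dvdp_map (ratr : {rmorphism rat -> algC})) => /dvdpP[q' ->].
  by rewrite rootM ft orbT.
by rewrite !conj0 // mul0r addr0.
Qed.

(** * Norms as products over embeddings *)

(** The conjugates of [z] are the eigenvalues of multiplication by [z]: for
    each embedding [u], the vector of the [sg u (v i)] is an eigenvector of [c]
    for the eigenvalue [sg u z]. *)
Lemma det_mul_conjugates (k L : fieldType) (K : fieldExtType k)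
    (phi : {rmorphism k -> L}) (n : nat) (sg : 'I_n -> {rmorphism K -> L})
    (v : 'I_n -> K) (z : K) (c : 'M[k]_n) :
    (forall u a, sg u a%:A = phi a) ->
    (forall i, v i * z = \sum_j c i j *: v j) ->
    \det (\matrix_(i, u) sg u (v i)) != 0 ->
  phi (\det c) = \prod_u sg u z.
Proof.
move=> sgk vz nzW; apply: (mulIf nzW); rewrite -det_map_mx -det_mulmx.
rewrite [RHS]mulrC; set W := \matrix_(i, u) _ in nzW *.
have -> : \prod_u sg u z = \det (diag_mx (\row_u sg u z)).
  by rewrite det_diag; apply: eq_bigr => u _; rewrite mxE.
rewrite -det_mulmx mul_mx_diag; congr (\det _); apply/matrixP => i u.
rewrite !mxE -rmorphM vz rmorph_sum; apply: eq_bigr => j _.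
by rewrite !mxE -mulr_algl rmorphM sgk.
Qed.

(** Nondegeneracy of the matrix of conjugates may be tested on any family [b]
    of [n] elements, since it factors through the one of a basis. *)
Lemma field_norm_conjugates (k L : fieldType) (K : fieldExtType k)
    (phi : {rmorphism k -> L}) (E : {subfield K}) (n : nat)
    (sg : 'I_n -> {rmorphism K -> L}) (b : 'I_n -> K) (z : K) :
    (forall u a, sg u a%:A = phi a) -> \dim E = n ->
    (forall i, b i \in E) -> \det (\matrix_(i, u) sg u (b i)) != 0 -> z \in E ->
  phi (field_norm E z) = \prod_u sg u z.
Proof.
move=> sgk dimE bE detb zE.
(* The size of vbasis E is not syntactically n: generalize it first. *)
suff key m (v : 'I_m -> K) (c : 'M_m) (d : 'I_n -> 'I_m -> k) : m = n ->
    (forall i, v i * z = \sum_j c i j *: v j) ->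
    (forall i, b i = \sum_j d i j *: v j) -> phi (\det c) = \prod_u sg u z.
  pose X := vbasis E.
  apply: (key _ (fun i => X`_i) _ (fun i j => coord X j (b i))) => // i.
    under eq_bigr do rewrite mxE.
    by apply: coord_vbasis; rewrite rpredM // vbasis_mem ?mem_nth ?size_tuple.
  exact: coord_vbasis.
move=> mn; subst m => vz bv.
apply: (@det_mul_conjugates _ _ _ _ _ _ _ _ _ sgk vz).
apply: contraNneq detb => v0.
rewrite (_ : matrix_of_fun _ _ =
    (\matrix_(i, j) phi (d i j)) *m (\matrix_(i, u) sg u (v i))).
  by rewrite det_mulmx v0 mulr0.
apply/matrixP => i u; rewrite !mxE bv rmorph_sum; apply: eq_bigr => j _.
by rewrite !mxE -mulr_algl rmorphM sgk.
Qed.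

Lemma dim_adjoin1_root (k : fieldType) (K : fieldExtType k) (f : {poly k})
    (x : K) : irreducible_poly f -> root (map_poly (in_alg K) f) x ->
  \dim <<1; x>> = (size f).-1.
Proof.
move=> f_irr fx; rewrite dim_Fadjoin dimv1 muln1.
have /polyOver1P[q qE] := minPolyOver 1 x.
have : minPoly 1 x %| map_poly (in_alg K) f.
  by apply: minPoly_dvdp fx; apply: alg_polyOver.
have sq : size q = (adjoin_degree 1 x).+1.
  by rewrite -(size_map_poly (in_alg K)) -qE size_minPoly.
rewrite qE dvdp_map => /(apply_irredp f_irr) qf.
by rewrite -(eqp_size (qf _)) sq.
Qed.

(** * Power integral bases and Vandermonde determinants *)

Lemma map_map_intr (R S : nzRingType) (phi : {rmorphism R -> S})
    (p : {poly int}) : map_poly phi (map_poly intr p) = map_poly intr p.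
Proof.
by rewrite -map_poly_comp; apply: eq_map_poly => x /=; rewrite rmorph_int.
Qed.

(** The powers of [a] below [n] are integer combinations [C] of [b].  Conversely
    each [b_i] is an integer polynomial in [a], of unknown degree; it may be
    reduced modulo the characteristic polynomial [chi] of multiplication by [a]
    on [b], a monic integer polynomial of degree [n] that annihilates every
    conjugate of [a].  This gives an integer matrix [P] with [P C = 1] up to the
    invertible matrix of conjugates, so [\det C] is a unit of Z. *)
Lemma power_basis_det (K : fieldType) (F : numFieldType) (n : nat)
    (b : n.-tuple K) (a : K) (sg : 'I_n -> {rmorphism K -> F}) :
  let B := \matrix_(i, u) sg u b`_i in
  generates_power_integral_basis (inIntSpan b) a -> \det B != 0 ->
  \det (Vandermonde n (\row_u sg u a)) = \det B \/
  \det (Vandermonde n (\row_u sg u a)) = - \det B.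
Proof.
move=> B aP detB0; set V := Vandermonde _ _.
have sg_horner u (q : {poly int}) :
    sg u (map_poly intr q).[a] = (map_poly intr q).[sg u a].
  by rewrite -horner_map map_map_intr.
have spanE u (c : int ^ n) :
    sg u (\sum_(i < n) b`_i *~ c i) = \sum_i (c i)%:~R * B i u.
  by rewrite rmorph_sum; apply: eq_bigr => i _; rewrite mxE rmorphMz /= mulrzl.
have spanZ (q : {poly int}) :
    exists c : int ^ n, (map_poly intr q).[a] = \sum_(i < n) b`_i *~ c i.
  exact/aP/(ex_intro _ q).
have pP (i : 'I_n) : exists q : {poly int}, b`_i = (map_poly intr q).[a].
  apply/aP; exists [ffun j => (j == i)%:Z].
  rewrite (bigD1 i) //= ffunE eqxx mulr1z.
  by rewrite big1 ?addr0 // => j /negPf ji; rewrite ffunE ji mulr0z.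
have [p pE] := fin_all_exists pP.
have cP (i : 'I_n) : exists c : int ^ n, a ^+ i = \sum_(j < n) b`_j *~ c j.
  by have [c cE] := spanZ 'X^i; exists c; rewrite -cE map_polyXn hornerXn.
have [c cE] := fin_all_exists cP.
have mP (i : 'I_n) : exists c : int ^ n, a * b`_i = \sum_(j < n) b`_j *~ c j.
  have [c' cE'] := spanZ ('X * p i); exists c'.
  by rewrite -cE' rmorphM /= map_polyX hornerM hornerX pE.
have [m mE] := fin_all_exists mP.
pose M := \matrix_(j, i) m i j; pose chi := char_poly M.
have chi0 u : (map_poly intr chi).[sg u a] = 0.
  apply/rootP; rewrite /chi map_char_poly -eigenvalue_root_char.
  apply/eigenvalueP; exists (row u B^T).
    apply/rowP => i; rewrite !mxE -rmorphM mE spanE.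
    by apply: eq_bigr => j _; rewrite !mxE mulrC.
  apply: contraNneq detB0 => Bu0; rewrite (expand_det_col _ u) big1 // => i _.
  by have /rowP/(_ i) := Bu0; rewrite !mxE => ->; rewrite mul0r.
pose r i := Pdiv.Ring.rmodp (p i) chi.
have chi_monic : chi \is monic by exact: char_poly_monic.
have size_r i : (size (r i) <= n)%N.
  rewrite -ltnS -(size_char_poly M) Pdiv.Ring.ltn_rmodpN0 //.
  exact: monic_neq0.
pose P := \matrix_(i < n, k < n) (r i)`_k; pose C := \matrix_(i, j) c i j.
have VE : V = map_mx intr C *m B.
  apply/matrixP => i u; rewrite !mxE -rmorphXn cE spanE.
  by apply: eq_bigr => j _; rewrite !mxE.
have BE : B = map_mx intr P *m V.
  apply/matrixP => i u; rewrite !mxE pE sg_horner.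
  rewrite (Pdiv.RingMonic.rdivp_eq chi_monic (p i)) rmorphD rmorphM /= -/(r i).
  rewrite hornerD hornerM chi0 mulr0 add0r (@horner_coef_wide _ n); last first.
    exact: leq_trans (size_poly _ _) (size_r i).
  by apply: eq_bigr => k _; rewrite !mxE coef_map.
have PC1 : \det P * \det C = 1.
  apply: (@intr_inj F); apply: (mulIf detB0).
  by rewrite [in RHS]BE VE !det_mulmx !det_map_mx !rmorphM mul1r mulrA.
have : (`|\det C| == 1)%N.
  move/(congr1 absz): PC1; rewrite abszM /= => /eqP.
  by rewrite muln_eq1 => /andP[].
rewrite VE det_mulmx det_map_mx; case: (\det C) => k /=.
  by move=> /eqP->; left; rewrite mul1r.
by move=> /eqP[->]; right; rewrite mulN1r.
Qed.

(** This is the Kronecker product of [V] with the matrix of the conjugates of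
    the basis [1, w] of a quadratic order. *)
Lemma det_quadratic_tensor (R : comPzRingType) (n : nat) (V : 'M[R]_n)
    (w w' : R) :
  \det (block_mx V V (w *: V) (w' *: V)) = (w' - w) ^+ n * \det V ^+ 2.
Proof.
(* Subtracting the first block column from the second. *)
have E : block_mx V V (w *: V) (w' *: V) *m block_mx 1%:M (- 1%:M) 0 1%:M =
    block_mx V 0 (w *: V) ((w' - w) *: V).
  rewrite mulmx_block !mulmx1 !mulmx0 !mulmxN !mulmx1 !addr0 addNr.
  by rewrite scalerBl addrC.
move/(congr1 determinant): E.
rewrite det_mulmx det_ublock det_lblock !det1 !mulr1 detZ => ->.
by rewrite mulrCA expr2.
Qed.

Lemma det_Vandermonde_cat (R : comPzRingType) (m n : nat) (a : 'rV[R]_m)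
    (b : 'rV[R]_n) :
  \det (Vandermonde (m + n) (row_mx a b)) =
  \det (Vandermonde m a) * \det (Vandermonde n b) *
  \prod_(i < m) \prod_(j < n) (b 0 j - a 0 i).
Proof.
rewrite !det_Vandermonde big_split_ord mulrAC /=; congr (_ * _).
  rewrite -big_split /=; apply: eq_bigr => i _; rewrite big_split_ord /=.
  congr (_ * _); first by apply: eq_bigr => j _; rewrite !row_mxEl.
  rewrite (eq_bigl xpredT) => [|j].
    by apply: eq_bigr => j _; rewrite row_mxEl row_mxEr.
  by rewrite /= ltn_addr.
apply: eq_bigr => i _; rewrite big_split_ord /= big_pred0 ?mul1r => [|j].
  by apply: eq_big => [j | j _]; rewrite ?ltn_add2l ?row_mxEr.
by rewrite ltnNge ltnW // ltn_addr.
Qed.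

Local Notation o0 := (ord0 : 'I_3).
Local Notation o1 := (lift ord0 ord0 : 'I_3).
Local Notation o2 := (lift ord0 (lift ord0 ord0) : 'I_3).

Lemma det_Vandermonde3 (R : comPzRingType) (a : 'rV[R]_3) :
  \det (Vandermonde 3 a) =
  (a 0 o1 - a 0 o0) * (a 0 o2 - a 0 o0) * (a 0 o2 - a 0 o1).
Proof.
rewrite det_Vandermonde.
under eq_bigr do rewrite big_mkcond.
by rewrite !big_ord_recl !big_ord0 /= !mulr1 !mul1r.
Qed.

Lemma map_monic_cubic (R : nzRingType) (a0 a1 a2 : int) :
  map_poly intr (monic_cubic a0 a1 a2) =
  'X^3 + a2%:~R%:P * 'X^2 + a1%:~R%:P * 'X + a0%:~R%:P :> {poly R}.
Proof.
rewrite /monic_cubic !rmorphD (rmorphM _ a2%:P) (rmorphM _ a1%:P) /=.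
by rewrite !map_polyXn map_polyX !map_polyC.
Qed.

Lemma monic_cubic_trace (R : idomainType) (a0 a1 a2 : int) (th : 'I_3 -> R) :
    injective th ->
    (forall j, root (map_poly intr (monic_cubic a0 a1 a2)) (th j)) ->
  a2%:~R = - \sum_j th j.
Proof.
move=> th_inj th_root.
have E j : th j ^+ 3 + a2%:~R * th j ^+ 2 + a1%:~R * th j + a0%:~R = 0.
  have /rootP := th_root j; rewrite map_monic_cubic.
  by rewrite !(hornerD, hornerM, hornerXn, hornerX, hornerC).
have nz i j : i != j -> th i - th j != 0.
  by move=> ij; rewrite subr_eq0 (inj_eq th_inj).
have nzD := mulf_neq0 (mulf_neq0 (nz o0 o1 isT) (nz o0 o2 isT)) (nz o1 o2 isT).
apply/eqP; rewrite -addr_eq0; apply/eqP/(mulfI nzD); rewrite mulr0.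
rewrite !big_ord_recl big_ord0.
(* The second divided difference of the cubic at its roots is a2 plus their
   sum. *)
pose p j := th j ^+ 3 + a2%:~R * th j ^+ 2 + a1%:~R * th j + a0%:~R.
have -> : (th o0 - th o1) * (th o0 - th o2) * (th o1 - th o2) *
    (a2%:~R + (th o0 + (th o1 + (th o2 + 0)))) =
    (p o0 - p o1) * (th o0 - th o2) - (p o0 - p o2) * (th o0 - th o1).
  by rewrite /p; ring.
by rewrite /p !E !subrr !mul0r subrr.
Qed.

(** For two roots [th j], [th k] with third root [th l], the quotient of
    [elt (th j) u - elt (th k) u] by [th j - th k] is
    [(x1 + u y1) + (th j + th k) (x2 + u y2)], that is [gam u l]. *)
Lemma det_conjugate_powers (th : 'I_3 -> algC) (w w' : algC) (a2 : int)
    (x0 x1 x2 y0 y1 y2 : int) :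
    a2%:~R = - \sum_j th j ->
  let al := \row_j elt (th j) w x0 x1 x2 y0 y1 y2 in
  let be := \row_j elt (th j) w' x0 x1 x2 y0 y1 y2 in
  let gam u l :=
    (x1%:~R + u * y1%:~R) - (a2%:~R + th l) * (x2%:~R + u * y2%:~R) in
  \det (Vandermonde (3 + 3) (row_mx al be)) =
    (w' - w) ^+ 3 * \det (Vandermonde 3 (\row_j th j)) ^+ 2 *
    ((\prod_j (y0%:~R + y1%:~R * th j + y2%:~R * th j ^+ 2)) *
     \prod_l (gam w l * gam w' l) * formF th w w' x1 x2 y0 y1 y2).
Proof.
move=> a2E al be gam.
have sameE u : \det (Vandermonde 3 (\row_j elt (th j) u x0 x1 x2 y0 y1 y2)) =
    \det (Vandermonde 3 (\row_j th j)) * \prod_l gam u l.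
  rewrite !det_Vandermonde3 !big_ord_recl big_ord0 !mxE /gam a2E.
  by rewrite !big_ord_recl big_ord0 /elt; ring.
have diffE : \prod_i \prod_j (be 0 j - al 0 i) =
    (w' - w) ^+ 3 * (\prod_j (y0%:~R + y1%:~R * th j + y2%:~R * th j ^+ 2)) *
    formF th w w' x1 x2 y0 y1 y2.
  under eq_bigr => i _ do rewrite (bigD1 i isT).
  rewrite (formF_x0 _ _ _ x0) big_split /=; congr (_ * _).
    have -> : (w' - w) ^+ 3 = \prod_(j < 3) (w' - w).
      by rewrite prodr_const card_ord.
    rewrite -big_split; apply: eq_bigr => j _.
    by rewrite !mxE /elt /=; ring.
  (* Each row has two sign changes. *)
  apply: eq_bigr => i _.
  under eq_bigr do rewrite !mxE -opprB.
  by rewrite prodrN cardC1 card_ord expr2 mulrNN !mul1r.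
rewrite det_Vandermonde_cat diffE /al /be !sameE big_split /=.
ring.
Qed.

(** * Integrality and size *)

Lemma monic_cubicP (a0 a1 a2 : int) :
  monic_cubic a0 a1 a2 \is monic /\ size (monic_cubic a0 a1 a2) = 4.
Proof.
rewrite /monic_cubic -!addrA.
have sr : (size (a2%:P * 'X^2 + (a1%:P * 'X + a0%:P))%R
           < size ('X^3 : {poly int}))%N.
  rewrite size_polyXn ltnS; apply/leq_sizeP => [[|[|[|j]]] // _].
  by rewrite !coefE /= !mulr0 !addr0.
split; first by rewrite monicE lead_coefDl // lead_coefXn.
by rewrite size_polyDl // size_polyXn.
Qed.

Lemma monic_cubic_Aint (a0 a1 a2 : int) (x : algC) :
  root (map_poly intr (monic_cubic a0 a1 a2)) x -> x \in Aint.
Proof.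
move=> /root_monic_Aint; apply.
  by rewrite monic_map ?(monic_cubicP _ _ _).1.
by apply/polyOverP => i; rewrite coef_map /= intr_int.
Qed.

Lemma omega_Aint (d : nat) (s : algC) : s ^+ 2 = - d%:R -> omega d s \in Aint.
Proof.
move=> s2.
suff [b [c E]] : exists b c : int,
    omega d s ^+ 2 + b%:~R * omega d s + c%:~R = 0.
  (* Multiplying the quadratic by X makes it a monic cubic. *)
  apply: (@monic_cubic_Aint 0 c b); rewrite map_monic_cubic /root.
  rewrite !(hornerD, hornerM, hornerXn, hornerX, hornerC).
  by rewrite -(mulr0 (omega d s)) -E; apply/eqP; ring.
rewrite /omega; case: ifP => [|_].
  rewrite eqz_mod_dvd => /dvdzP[q qE]; exists (-1), (- q).
  have {}qE : s ^+ 2 = q%:~R * 4 + 1.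
    rewrite s2; have := congr1 (intr : int -> algC) qE.
    by rewrite rmorphB rmorphN rmorphM /= => <-; ring.
  transitivity ((s ^+ 2 - (q%:~R * 4 + 1)) / 4); last by rewrite qE subrr mul0r.
  by field.
by exists 0, d%:Z; rewrite s2 mul0r addr0 addNr.
Qed.

(** The inverse of [x] is [+- y], so both are rational algebraic integers,
    that is, integers. *)
Lemma Crat_Aint_unit (x y : algC) : x \in Crat -> x \in Aint -> y \in Aint ->
  x * y = 1 \/ x * y = -1 -> x = 1 \/ x = -1.
Proof.
move=> xQ xA yA xy1.
have [e eE xye] : exists2 e : algC, e = 1 \/ e = -1 & x * y = e.
  by exists (x * y).
have x0 : x != 0.
  apply: contra_eq_neq xye => ->; rewrite mul0r eq_sym.
  by case: eE => ->; rewrite ?oppr_eq0 oner_eq0.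
have yQ : y \in Crat.
  rewrite -[y](mulKf x0) xye mulrC rpredM ?rpredV //.
  by case: eE => ->; rewrite ?rpredN rpred1.
have /intrP[m xm] := Cint_rat_Aint xQ xA.
have /intrP[n yn] := Cint_rat_Aint yQ yA.
have : absz (m * n) = 1%N.
  move: xy1; rewrite xm yn -rmorphM /= => -[/(@intr_inj _ _ 1) -> //|].
  by rewrite -[-1]/((-1)%:~R) => /intr_inj ->.
rewrite abszM xm => /eqP; rewrite muln_eq1 => /andP[+ _]; case: m {xm} => k /=.
  by move/eqP->; left.
by move/eqP=> [->]; right.
Qed.

Lemma norm_prod_le (I : finType) (u v : I -> algC) (M : algC) :
    (forall i, u i \is Num.real) -> (forall i, v i \is Num.real) -> 0 <= M ->
    \prod_i (u i ^+ 2 + v i ^+ 2) = M ^+ 2 ->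
  `|\prod_i u i| <= M.
Proof.
move=> uR vR M0 E; rewrite -(ler_pXn2r (ltn0Sn 1)) ?nnegrE //.
rewrite -E normr_prod -prodrXl; apply: ler_prod => i _.
by rewrite exprn_ge0 //= real_normK // lerDl -realEsqr.
Qed.

(** * The index form equation *)

Lemma rmorph_omega (R S : fieldType) (phi : {rmorphism R -> S}) d s :
  phi (omega d s) = omega d (phi s).
Proof.
rewrite /omega; case: ifP => // _.
by rewrite fmorph_div rmorphD rmorph1 rmorph_nat.
Qed.

Lemma rmorph_elt (R S : comNzRingType) (phi : {rmorphism R -> S})
    t w x0 x1 x2 y0 y1 y2 :
  phi (elt t w x0 x1 x2 y0 y1 y2) = elt (phi t) (phi w) x0 x1 x2 y0 y1 y2.
Proof. by rewrite /elt !rmorphD !rmorphM !rmorph_int. Qed.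

Theorem theorem1
  (a0 a1 a2 : int) (d : nat)
  (f_irr : irreducible_poly (map_poly intr (monic_cubic a0 a1 a2) : {poly rat}))
  (th : 'I_3 -> algC)
  (th_real : forall j, th j \is Num.real)
  (th_inj : injective th)
  (th_root : forall j, root (map_poly intr (monic_cubic a0 a1 a2)) (th j))
  (d_gt0 : (0 < d)%N) (d_sqfree : squarefree d)
  (* K = Q(theta, i sqrt d) as a subfield of the complex numbers *)
  (K : fieldExtType rat) (iota : {rmorphism K -> algC})
  (theta s : K)
  (iota_theta : iota theta = th ord0)
  (iota_s : iota s = 'i * sqrtC d%:R)
  (K_gen : <<1 & [:: theta; s]>>%VS = {:K}%VS)
  (x0 x1 x2 y0 y1 y2 : int)
  (alpha_pib : generates_power_integral_basis (order_O theta (omega d s))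
                 (elt theta (omega d s) x0 x1 x2 y0 y1 y2)) :
  let w := iota (omega d s) in
  let NL (z : K) : rat := field_norm <<1; theta>>%VS z in
  let F := formF th w w^* x1 x2 y0 y1 y2 in
  [/\ F = 1 \/ F = -1,
      (let N := NL (y0%:~R + y1%:~R * theta + y2%:~R * theta ^+ 2) in
       N = 1 \/ N = -1),
      (- d%:Z = 2 %[mod 4])%Z \/ (- d%:Z = 3 %[mod 4])%Z ->
        `|NL (x1%:~R - (a2%:~R + theta) * x2%:~R)| <= 1 /\
        `|ratr (NL (y1%:~R - (a2%:~R + theta) * y2%:~R))|
          <= 1 / sqrtC (d%:R : algC) ^+ 3
    & (- d%:Z = 1 %[mod 4])%Z ->
        `|NL ((2 * x1 + y1)%:~R - (a2%:~R + theta) * (2 * x2 + y2)%:~R)| <= 8 /\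
        `|ratr (NL (y1%:~R - (a2%:~R + theta) * y2%:~R))|
          <= 8 / sqrtC (d%:R : algC) ^+ 3].
Proof.
move=> w NL F.
pose S := iota s; pose r : algC := sqrtC d%:R.
have rgt0 : 0 < r by rewrite sqrtC_gt0 ltr0n.
have rR : r \is Num.real by rewrite gtr0_real.
have S2 : S ^+ 2 = - d%:R by rewrite /S iota_s exprMn sqrCi sqrtCK mulN1r.
have Sconj : S^* = - S.
  by rewrite /S iota_s rmorphM /= conjCi (CrealP rR) mulNr.
have S_neq0 : S != 0 by rewrite /S iota_s mulf_neq0 ?neq0Ci // gt_eqF.
have s2 : s ^+ 2 = (- d%:R)%:A.
  apply: (fmorph_inj iota); rewrite rmorphXn S2 -[_%:A]/(in_alg K _).
  by rewrite !rmorphN !rmorph_nat.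
have SNreal : S \isn't Num.real by rewrite CrealE Sconj eqNr.
have thetaR : iota theta \is Num.real by rewrite iota_theta.
pose f : {poly rat} := map_poly intr (monic_cubic a0 a1 a2).
have f_root j : root (map_poly ratr f) (th j) by rewrite /f map_map_intr.
have size_f : size f = 4.
  by rewrite size_map_inj_poly ?(monic_cubicP _ _ _).2 //; apply: intr_inj.
have sgP (j : 'I_3) :
    exists sg : {rmorphism K -> algC}, sg theta = th j /\ sg s = S.
  apply: (@conjugate_embedding f _ _ _ _ (- d%:R)) => //.
  by rewrite iota_theta.
have [sg sgE] := fin_all_exists sgP.
have sgth j : sg j theta = th j by case: (sgE j).
have sgw j : sg j (omega d s) = w.
  by rewrite rmorph_omega (sgE j).2 /w rmorph_omega.
(* Writing w = (t + c S) / 2 treats the two shapes of omega at once, until the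
   values of t and c are needed. *)
have [t [c [cC cgt0 wE]]] : exists t c : int,
    [/\ if (- d%:Z == 1 %[mod 4])%Z then t = 1 /\ c = 1 else t = 0 /\ c = 2,
        0 < c & w = (t%:~R + c%:~R * S) / 2].
  rewrite /w rmorph_omega -/S /omega; case: ifP => _.
    by exists 1, 1; rewrite mul1r.
  by exists 0, 2; split=> //; field.
have wE' : w^* = (t%:~R - c%:~R * S) / 2.
  rewrite wE fmorph_div rmorphD rmorphM /= Sconj.
  by rewrite !rmorph_int rmorph_nat mulrN.
have cneq0 : (c%:~R : algC) != 0 by rewrite intr_eq0 gt_eqF.
have ww' : w^* - w != 0.
  rewrite wE' wE (_ : _ - _ = - (c%:~R * S)); last by field.
  by rewrite oppr_eq0 mulf_neq0.
pose al := elt theta (omega d s) x0 x1 x2 y0 y1 y2.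
(* Composing with complex conjugation keeps the real th j and exchanges w and
   its conjugate: this gives the other three embeddings. *)
pose sg6 (u : 'I_6) : {rmorphism K -> algC} :=
  match @split 3 3 u with inl j => sg j | inr j => (Num.conj_op \o sg j) end.
have sg6l (j : 'I_3) : sg6 (@lshift 3 3 j) = sg j.
  by rewrite /sg6 (unsplitK (inl j)).
have sg6r (j : 'I_3) : sg6 (@rshift 3 3 j) = (Num.conj_op \o sg j).
  by rewrite /sg6 (unsplitK (inr j)).
have a2E := @monic_cubic_trace algC a0 a1 a2 th th_inj th_root.
set V := Vandermonde 3 (\row_j th j).
have Vneq0 : \det V != 0.
  by rewrite det_Vandermonde3 !mxE !mulf_neq0 // subr_eq0 (inj_eq th_inj).
have thC j : (th j)^* = th j by exact/CrealP.
pose b := [tuple 1; theta; theta ^+ 2; omega d s; omega d s * theta;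
                 omega d s * theta ^+ 2].
have basisE : \matrix_(i, u) sg6 u b`_i = block_mx V V (w *: V) (w^* *: V).
  suff bE (i u : 'I_(3 + 3)) :
      sg6 u b`_i = block_mx V V (w *: V) (w^* *: V) i u.
    by apply/matrixP => i u; rewrite mxE bE.
  case: (split_ordP i) => i' ->; case: (split_ordP u) => u' ->;
  rewrite ?block_mxEul ?block_mxEur ?block_mxEdl ?block_mxEdr !mxE ?sg6l ?sg6r;
  case: i' => [[|[|[|//]]] ?] /=;
  (* Twice, for sg j and then for the conjugation around it. *)
  rewrite ?(rmorph1, rmorphXn, rmorphM) /= ?(rmorph1, rmorphXn, rmorphM) /=
    ?sgth ?sgw ?thC ?expr0 ?expr1 ?mulr1 //.
have powE : \row_u sg6 u al =
    row_mx (\row_j elt (th j) w x0 x1 x2 y0 y1 y2)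
           (\row_j elt (th j) w^* x0 x1 x2 y0 y1 y2) :> 'rV_(3 + 3).
  apply/rowP => k; rewrite mxE.
  case: (@split_ordP 3 3 k) => j ->;
    rewrite ?row_mxEl ?row_mxEr mxE ?sg6l ?sg6r.
    by rewrite rmorph_elt sgth sgw.
  by rewrite /= rmorph_elt sgth sgw rmorph_elt /= thC.
pose X l := x1%:~R - (a2%:~R + th l) * x2%:~R.
pose Y l := y1%:~R - (a2%:~R + th l) * y2%:~R.
pose N := \prod_j (y0%:~R + y1%:~R * th j + y2%:~R * th j ^+ 2).
pose P l := 2 * X l + t%:~R * Y l.
pose G := \prod_l ((P l ^+ 2 + (c%:~R * r * Y l) ^+ 2) / 4).
have gamE l : (x1%:~R + w * y1%:~R - (a2%:~R + th l) * (x2%:~R + w * y2%:~R)) *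
    (x1%:~R + w^* * y1%:~R - (a2%:~R + th l) * (x2%:~R + w^* * y2%:~R)) =
    (P l ^+ 2 + (c%:~R * r * Y l) ^+ 2) / 4.
  rewrite exprMn exprMn sqrtCK -[d%:R]opprK -S2 wE' wE /P /X /Y.
  by field.
have NGF : N * G * F = 1 \/ N * G * F = -1.
  have := det_conjugate_powers th w w^* a2 x0 x1 x2 y0 y1 y2 a2E.
  cbv zeta; rewrite (eq_bigr _ (fun l _ => gamE l)) -/N -/G -/F -/V => detE.
  have detB : \det (block_mx V V (w *: V) (w^* *: V)) != 0.
    by rewrite det_quadratic_tensor mulf_neq0 ?expf_neq0.
  have := @power_basis_det K algC 6 _ al sg6 alpha_pib.
  rewrite basisE => /(_ detB); rewrite powE detE -det_quadratic_tensor.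
  move=> [] E; [left|right]; apply: (mulfI detB).
    by rewrite mulr1 -[RHS]E.
  by rewrite mulrN1 -[RHS]E.
have thA j : th j \in Aint by exact: monic_cubic_Aint (th_root j).
have wA : w \in Aint by rewrite /w rmorph_omega omega_Aint.
have wA' : w^* \in Aint by rewrite (Aint_aut Num.conj_op).
have eltA j u y : u \in Aint -> elt (th j) u y x1 x2 y0 y1 y2 \in Aint.
  by move=> uA; rewrite /elt !(rpredD, rpredM, rpredX, Aint_int, uA, thA).
have NA : N \in Aint.
  by apply: rpred_prod => j _; rewrite !(rpredD, rpredM, rpredX, Aint_int, thA).
have GA : G \in Aint.
  apply: rpred_prod => l _; rewrite -gamE.
  by rewrite !(rpredB, rpredD, rpredM, Aint_int, thA, wA, wA').
have FA : F \in Aint.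
  by apply: rpred_prod => j _; apply: rpred_prod => k _; rewrite rpredB ?eltA.
have NL_prod z : z \in <<1; theta>>%VS -> ratr (NL z) = \prod_j sg j z.
  apply: (@field_norm_conjugates _ _ _ ratr _ _ sg (fun i => theta ^+ i)).
  - by move=> u a; exact: (fmorph_eq_rat (sg u \o in_alg K)).
  - rewrite (@dim_adjoin1_root _ _ f) ?size_f //.
    by rewrite -(fmorph_root iota) map_map_intr map_map_intr iota_theta.
  - by move=> i; rewrite rpredX ?memv_adjoin.
  rewrite (_ : matrix_of_fun _ _ = V) //.
  by apply/matrixP => i u; rewrite !mxE rmorphXn sgth.
have gE z := (memv_adjoin 1 theta, rpred_int <<1; theta>>%AS z).
have NE : ratr (NL (y0%:~R + y1%:~R * theta + y2%:~R * theta ^+ 2)) = N.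
  rewrite NL_prod; last by rewrite !(rpredD, rpredM, rpredX, gE).
  by apply: eq_bigr => j _; rewrite !(rmorphD, rmorphM, rmorph_int) /= !sgth.
have relE (u v : int) : ratr (NL (u%:~R - (a2%:~R + theta) * v%:~R)) =
    \prod_l (u%:~R - (a2%:~R + th l) * v%:~R).
  rewrite NL_prod; last by rewrite !(rpredB, rpredD, rpredM, gE).
  by apply: eq_bigr => j _; rewrite rmorphB rmorphM rmorphD !rmorph_int /= sgth.
(* gamma_l gamma_l' is the l-th conjugate of an element z of Q(theta). *)
have GQ : G \in Crat.
  pose Xt := x1%:~R - (a2%:~R + theta) * x2%:~R.
  pose Yt := y1%:~R - (a2%:~R + theta) * y2%:~R.
  pose z := ((2 * Xt + t%:~R * Yt) ^+ 2 + (c%:~R * Yt) ^+ 2 * d%:~R) / 4.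
  suff -> : G = ratr (NL z) by exact: Crat_rat.
  rewrite NL_prod; last first.
    rewrite /z /Xt /Yt.
    by rewrite !(rpred_div, rpred_nat, rpredB, rpredD, rpredM, rpredX, gE).
  apply: eq_bigr => l _.
  rewrite /z /Xt /Yt fmorph_div.
  rewrite !(rmorph_nat, rmorph_int, rmorphXn, rmorphB, rmorphD, rmorphM) /=.
  rewrite !sgth.
  by congr (_ / _); rewrite exprMn exprMn sqrtCK /P /X /Y; ring.
have NQ : N \in Crat by rewrite -NE Crat_rat.
have N1 : N = 1 \/ N = -1.
  by apply: (@Crat_Aint_unit _ (G * F)); rewrite ?rpredM // mulrA.
have PR l : P l \is Num.real.
  by rewrite /P /X /Y !(rpred_nat, rpred_int, rpredB, rpredD, rpredM, th_real).
have QR l : c%:~R * r * Y l \is Num.real.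
  by rewrite /Y !(rpred_int, rpredB, rpredD, rpredM, th_real, rR).
have G1 : G = 1.
  have : G = 1 \/ G = -1.
    by apply: (@Crat_Aint_unit _ (N * F)); rewrite ?rpredM // mulrCA mulrA.
  have G0 : 0 <= G.
    by apply: prodr_ge0 => l _; rewrite divr_ge0 ?addr_ge0 // -realEsqr.
  by case=> // Gm; move: G0; rewrite Gm oppr_ge0 ler10.
have F1 : F = 1 \/ F = -1.
  move: NGF; rewrite G1 mulr1; case: N1 => ->; first by rewrite mul1r.
  rewrite mulN1r => -[/eqP|/eqP]; rewrite eqr_oppLR ?opprK => /eqP;
  by [right | left].
(* 8^2 = 4^3 comes from the denominators in G. *)
have sumE : \prod_l (P l ^+ 2 + (c%:~R * r * Y l) ^+ 2) = 8 ^+ 2.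
  move: G1; rewrite /G prodf_div prodr_const card_ord => /(canRL (divfK _)) ->.
    by rewrite mul1r -!natrX.
  by rewrite expf_neq0 // pnatr_eq0.
have bP : `|\prod_l P l| <= 8 by exact: (norm_prod_le _ _ _ _ PR QR).
have bQ : `|\prod_l Y l| <= 8 / (c%:~R * r) ^+ 3.
  have cr0 : 0 < c%:~R * r :> algC by rewrite mulr_gt0 ?ltr0z.
  rewrite ler_pdivlMr ?exprn_gt0 // mulrC.
  rewrite -(gtr0_norm (exprn_gt0 3 cr0)) -normrM.
  have <- : \prod_l (c%:~R * r * Y l) = (c%:~R * r) ^+ 3 * \prod_l Y l.
    by rewrite big_split prodr_const card_ord.
  apply: (norm_prod_le _ _ _ _ QR PR) => //.
  by rewrite -sumE; apply: eq_bigr => l _; rewrite addrC.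
have normNL z : (ratr `|NL z| : algC) = `|ratr (NL z)| by exact: ratr_norm.
split=> //.
- move=> n; case: N1 => E; [left|right];
  apply: (fmorph_inj (ratr : {rmorphism rat -> algC}));
  by rewrite /= /n NE E ?rmorphN rmorph1.
- move=> dmod; have [t0 c2] : t = 0 /\ c = 2.
    by move: cC; case: dmod => ->.
  have PE : \prod_l P l = 8 * \prod_l X l.
    rewrite (_ : 8 = \prod_(l < 3) 2); last first.
      by rewrite prodr_const card_ord -natrX.
    by rewrite -big_split; apply: eq_bigr => l _; rewrite /P t0 mul0r addr0.
  split; last first.
    rewrite relE (le_trans bQ) // c2 exprMn invfM mulrA -natrX divff //.
    by rewrite pnatr_eq0.
  rewrite -(ler_rat algC) normNL rmorph1 relE.
  rewrite -(ler_pM2l (ltr0n algC 8)) mulr1.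
  by move: bP; rewrite PE normrM normr_nat.
- move=> dmod; have [t1 c1] : t = 1 /\ c = 1.
    by move: cC; rewrite dmod eqxx.
  split; last by move: bQ; rewrite relE c1 mul1r.
  rewrite -(ler_rat algC) normNL rmorph_nat relE.
  suff -> : \prod_l ((2 * x1 + y1)%:~R - (a2%:~R + th l) * (2 * x2 + y2)%:~R) =
    \prod_l P l by [].
  apply: eq_bigr => l _; rewrite /P /X /Y t1 !rmorphD !rmorphM /=; ring.
Qed.
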